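(* Let $f\colon R\to S$ be a strongly right taut continuous map of two-sided linear topological rings. Then the following two conditions are equivalent: (1) the functor of restriction of scalars $f_\diamond\colon\mathsf{Discr}\text{-}S\to\mathsf{Discr}\text{-}R$ is fully faithful; (2) $f$ is a topological ring proepimorphism.
   Context: All rings are associative and unital, and ring maps are unital ring homomorphisms. A topological ring is two-sided linear if open two-sided ideals form a base of neighborhoods of zero. (The rings here are not assumed complete or separated.) For a ring map $f\colon R\to S$ and a subset $I\subset R$, $f(I)S$ denotes the right ideal of $S$ generated by $f(I)$. A ring map $f\colon R\to S$ of two-sided linear topological rings is strongly right taut if those open two-sided ideals $I\subset R$ for which the closure $J$ of the right ideal $f(I)S$ in $S$ is an open two-sided ideal of $S$ form a base of neighborhoods of zero in $R$. A continuous homomorphism $f\colon R\to S$ of two-sided linear topological rings is a topological ring proepimorphism if, for all open two-sided ideals $I\subset R$ and $J\subset S$ with $f(I)\subset J$, the induced map of discrete quotient rings $R/I\to S/J$ is an epimorphism in the category of associative unital rings. A right $R$-module is discrete if the annihilator of each of its elements is an open right ideal in $R$; $\mathsf{Discr}\text{-}R$ is the full subcategory of discrete modules in the category of right $R$-modules. For a continuous $f$, every discrete right $S$-module is discrete as a right $R$-module, and $f_\diamond$ is the resulting restriction-of-scalars functor. *)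

(* Defs.v *)
From HB Require Import structures.
From mathcomp Require Import all_boot all_algebra.
From mathcomp Require Import all_classical.
From mathcomp Require Import topology tvs.

Set Implicit Arguments.
Unset Strict Implicit.
Unset Printing Implicit Defensive.

Import GRing.Theory.

Local Open Scope classical_set_scope.
Local Open Scope ring_scope.
Local Open Scope quotient_scope.

(* Rings are [pzRingType]s: associative and unital, the zero ring included
   (it occurs as the quotient of a ring by the unit ideal). *)

HB.mixin Record TopologicalZmodule_isTopologicalPzRing R
    & Topological R & GRing.PzRing R := {
  mul_continuous : continuous (fun x : R * R => x.1 * x.2)
}.

#[short(type="topologicalPzRingType")]
HB.structure Definition TopologicalPzRing :=
  {R of TopologicalZmodule R & GRing.PzRing R
        & TopologicalZmodule_isTopologicalPzRing R}.

(* Closure under opposites follows from closure under multiplication by -1. *)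
Definition right_ideal (R : pzRingType) (I : set R) : Prop :=
  [/\ I 0, forall x y, I x -> I y -> I (x + y) & forall x a, I x -> I (x * a)].

Definition left_ideal (R : pzRingType) (I : set R) : Prop :=
  [/\ I 0, forall x y, I x -> I y -> I (x + y) & forall a x, I x -> I (a * x)].

Definition two_sided_ideal (R : pzRingType) (I : set R) : Prop :=
  left_ideal I /\ right_ideal I.

Definition nbhs_base (T : topologicalType) (x : T) (B : set (set T)) : Prop :=
  B `<=` nbhs x /\ forall U, nbhs x U -> exists2 V, B V & V `<=` U.

Definition two_sided_linear (R : topologicalPzRingType) : Prop :=
  nbhs_base (0 : R) [set I | open I /\ two_sided_ideal I].

Definition strongly_right_taut (R S : topologicalPzRingType)
    (f : {rmorphism R -> S}) : Prop :=
  nbhs_base (0 : R) [set I |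
    [/\ open I, two_sided_ideal I &
        let J := closure (smallest (@right_ideal S) (f @` I)) in
        open J /\ two_sided_ideal J]].

(* The quotient of a ring by a two-sided ideal; the library only provides the
   ring structure when the ring is commutative and the ideal is proper. *)

Record twosidedIdeal (R : pzRingType) := TwosidedIdeal {
  ideal_set :> set R;
  twosided_idealP : two_sided_ideal ideal_set
}.

Definition ideal_pred (R : pzRingType) (I : twosidedIdeal R) : {pred R} :=
  fun x => `[< ideal_set I x >].

Section QuotientRing.
Variables (R : pzRingType) (I : twosidedIdeal R).

Lemma ideal_pred_zmod_closed : zmod_closed (ideal_pred I).
Proof.
have [_ [I0 ID IM]] := twosided_idealP I.
split=> [|x y /asboolP Ix /asboolP Iy]; apply/asboolP => //.
by apply: ID => //; rewrite -mulrN1; exact: IM.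
Qed.

HB.instance Definition _ :=
  GRing.isZmodClosed.Build R (ideal_pred I) ideal_pred_zmod_closed.

Definition quotient_ring : Type := @Quotient.quot R (ideal_pred I).

HB.instance Definition _ := GRing.Zmodule.on quotient_ring.

Definition quotient_proj (x : R) : quotient_ring := \pi_(@Quotient.quot R (ideal_pred I)) x.

Definition quotient_repr (x : quotient_ring) : R :=
  repr (x : (@Quotient.quot R (ideal_pred I))).

Lemma quotient_reprK : cancel quotient_repr quotient_proj.
Proof. exact: reprK. Qed.

Lemma quotient_projP (x y : R) :
  quotient_proj x = quotient_proj y <-> ideal_set I (x - y).
Proof.
split=> [/eqP|Ixy].
  by rewrite /quotient_proj -Quotient.idealrBE => /asboolP.
by apply/eqP; rewrite /quotient_proj -Quotient.idealrBE; apply/asboolP.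
Qed.

Lemma quotient_projD (x y : R) :
  quotient_proj (x + y) = quotient_proj x + quotient_proj y.
Proof. exact: raddfD. Qed.

Definition quotient_one : quotient_ring := quotient_proj 1.

Definition quotient_mul (x y : quotient_ring) : quotient_ring :=
  quotient_proj (quotient_repr x * quotient_repr y).

Lemma quotient_projM (x y : R) :
  quotient_proj (x * y) = quotient_mul (quotient_proj x) (quotient_proj y).
Proof.
have [[_ _ IL] [_ ID IM]] := twosided_idealP I.
have kerP z : ideal_set I (z - quotient_repr (quotient_proj z)).
  by apply/quotient_projP; rewrite quotient_reprK.
apply/quotient_projP; move: (kerP x) (kerP y).
move: (quotient_repr (_ x)) (quotient_repr (_ y)) => x' y' Ix Iy.
have -> : x * y - x' * y' = (x - x') * y + x' * (y - y').
  by rewrite mulrBl mulrBr addrA subrK.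
by apply: ID; [exact: IM | exact: IL].
Qed.

Fact quotient_mulA : associative quotient_mul.
Proof.
move=> x y z; rewrite -(quotient_reprK x) -(quotient_reprK y).
by rewrite -(quotient_reprK z) -!quotient_projM mulrA.
Qed.

Fact quotient_mul1l : left_id quotient_one quotient_mul.
Proof.
by move=> x; rewrite -(quotient_reprK x) -quotient_projM mul1r.
Qed.

Fact quotient_mul1r : right_id quotient_one quotient_mul.
Proof.
by move=> x; rewrite -(quotient_reprK x) -quotient_projM mulr1.
Qed.

Fact quotient_mulDl : left_distributive quotient_mul +%R.
Proof.
move=> x y z; rewrite -(quotient_reprK x) -(quotient_reprK y).
rewrite -(quotient_reprK z) -quotient_projD -!quotient_projM.
by rewrite -quotient_projD mulrDl.
Qed.

Fact quotient_mulDr : right_distributive quotient_mul +%R.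
Proof.
move=> x y z; rewrite -(quotient_reprK x) -(quotient_reprK y).
rewrite -(quotient_reprK z) -quotient_projD -!quotient_projM.
by rewrite -quotient_projD mulrDr.
Qed.

HB.instance Definition _ := GRing.Zmodule_isPzRing.Build quotient_ring
  quotient_mulA quotient_mul1l quotient_mul1r quotient_mulDl quotient_mulDr.

Fact quotient_proj_zmod_morphism : zmod_morphism quotient_proj.
Proof. exact: raddfB. Qed.

HB.instance Definition _ := GRing.isZmodMorphism.Build R quotient_ring
  quotient_proj quotient_proj_zmod_morphism.

Fact quotient_proj_monoid_morphism : monoid_morphism quotient_proj.
Proof. by split; [|exact: quotient_projM]. Qed.

HB.instance Definition _ := GRing.isMonoidMorphism.Build R quotient_ring
  quotient_proj quotient_proj_monoid_morphism.

End QuotientRing.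

Section QuotientMap.
Variables (R S : pzRingType) (f : {rmorphism R -> S}).
Variables (I : twosidedIdeal R) (J : twosidedIdeal S).

Definition quotient_map (fIJ : f @` I `<=` J) (x : quotient_ring I) :
    quotient_ring J :=
  quotient_proj J (f (quotient_repr x)).

Variable fIJ : f @` I `<=` J.

Lemma quotient_map_proj (x : R) :
  quotient_map fIJ (quotient_proj I x) = quotient_proj J (f x).
Proof.
apply/quotient_projP; rewrite -rmorphB; apply: fIJ; exists (
  quotient_repr (quotient_proj I x) - x) => //.
by apply/quotient_projP; rewrite quotient_reprK.
Qed.

Fact quotient_map_zmod_morphism : zmod_morphism (quotient_map fIJ).
Proof.
move=> x y; rewrite -(quotient_reprK x) -(quotient_reprK y).
by rewrite -rmorphB !quotient_map_proj !rmorphB.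
Qed.

Fact quotient_map_monoid_morphism : monoid_morphism (quotient_map fIJ).
Proof.
split; first by rewrite -(rmorph1 (quotient_proj I)) quotient_map_proj !rmorph1.
move=> x y; rewrite -(quotient_reprK x) -(quotient_reprK y).
by rewrite -rmorphM !quotient_map_proj !rmorphM.
Qed.

HB.instance Definition _ := GRing.isZmodMorphism.Build
  (quotient_ring I) (quotient_ring J) (quotient_map fIJ)
  quotient_map_zmod_morphism.
HB.instance Definition _ := GRing.isMonoidMorphism.Build
  (quotient_ring I) (quotient_ring J) (quotient_map fIJ)
  quotient_map_monoid_morphism.

End QuotientMap.

Definition ring_epimorphism (A B : pzRingType) (p : {rmorphism A -> B}) : Prop :=
  forall (T : pzRingType) (g h : {rmorphism B -> T}),
    g \o p =1 h \o p -> g =1 h.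

Definition topological_ring_proepimorphism (R S : topologicalPzRingType)
    (f : {rmorphism R -> S}) : Prop :=
  continuous f /\
  forall (I : twosidedIdeal R) (J : twosidedIdeal S) (fIJ : f @` I `<=` J),
    open (I : set R) -> open (J : set S) ->
    ring_epimorphism (quotient_map fIJ).

(* Right R-modules are [lmodType]s over the converse ring R^c: the right action
   x . r is written (r : R^c) *: x, so that (x . r) . s = x . (r * s). *)

Definition annihilator (R : pzRingType) (M : lmodType R^c) (x : M) : set R :=
  [set r | (r : R^c) *: x = 0].

Lemma annihilator_right_ideal (R : pzRingType) (M : lmodType R^c) (x : M) :
  right_ideal (annihilator x).
Proof.
split=> [|r s rx sx|r a rx]; rewrite /annihilator /=.
- exact: scale0r.
- by rewrite (scalerDl x (r : R^c) (s : R^c)) rx sx addr0.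
- by rewrite -(scalerA (a : R^c) (r : R^c) x) rx scaler0.
Qed.

Definition discrete_module (R : topologicalPzRingType) (M : lmodType R^c) :
    Prop :=
  forall x : M, open (annihilator x) /\ right_ideal (annihilator x).

(* The objects of Discr-R; morphisms from M to N are all R-linear maps, that
   is, the elements of [{linear M -> N}]. *)
Record discrModule (R : topologicalPzRingType) := DiscrModule {
  discr_lmod :> lmodType R^c;
  discr_lmodP : discrete_module discr_lmod
}.

(* Restriction of scalars along f for modules: the additive group of M, with
   x . r := x . (f r). *)
Definition restrict (R S : pzRingType) (f : {rmorphism R -> S})
    (M : lmodType S^c) : Type := M.

Section RestrictScalars.
Variables (R S : pzRingType) (f : {rmorphism R -> S}) (M : lmodType S^c).

HB.instance Definition _ := GRing.Zmodule.copy (restrict f M) M.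

Definition restrict_scale (r : R^c) (x : restrict f M) : restrict f M :=
  (f r : S^c) *: (x : M).

Fact restrict_scaleA r s x :
  restrict_scale r (restrict_scale s x) = restrict_scale (r * s) x.
Proof.
rewrite /restrict_scale -[f (r * s)]/(f ((s : R) * (r : R))) rmorphM.
exact: (scalerA (f r : S^c) (f s : S^c) (x : M)).
Qed.

Fact restrict_scale1 : left_id 1 restrict_scale.
Proof.
by move=> x; rewrite /restrict_scale (rmorph1 f) (scale1r (x : M)).
Qed.

Fact restrict_scaleDr : right_distributive restrict_scale +%R.
Proof. by move=> r x y; exact: (scalerDr (f r : S^c) (x : M) (y : M)). Qed.

Fact restrict_scaleDl x : {morph restrict_scale^~ x : r s / r + s}.
Proof.
move=> r s; rewrite /restrict_scale -[f (r + s)]/(f ((r : R) + (s : R))) rmorphD.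
exact: (scalerDl (x : M) (f r : S^c) (f s : S^c)).
Qed.

HB.instance Definition _ := GRing.Zmodule_isLmodule.Build R^c (restrict f M)
  restrict_scaleA restrict_scale1 restrict_scaleDr restrict_scaleDl.

End RestrictScalars.

Section RestrictionFunctor.
Variables (R S : topologicalPzRingType) (f : {rmorphism R -> S}).
Hypothesis f_continuous : continuous f.

Fact restrict_discrete (M : discrModule S) :
  discrete_module (restrict f M : lmodType R^c).
Proof.
move=> x; split; last exact: annihilator_right_ideal.
have [ox _] := discr_lmodP (x : M).
by move/continuousP: f_continuous => /(_ _ ox).
Qed.

Definition restrict_obj (M : discrModule S) : discrModule R :=
  DiscrModule (@restrict_discrete M).

Section Map.
Variables (M N : discrModule S) (g : {linear M -> N}).

Definition restrict_fun (x : restrict_obj M) : restrict_obj N := g (x : M).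

Fact restrict_fun_linear : linear restrict_fun.
Proof. by move=> r x y; exact: (linearP g (f r : S^c) (x : M) (y : M)). Qed.

HB.instance Definition _ := GRing.isLinear.Build R^c
  (restrict_obj M) (restrict_obj N) *:%R restrict_fun restrict_fun_linear.

Definition restrict_map : {linear restrict_obj M -> restrict_obj N} :=
  restrict_fun.

End Map.

Lemma restrict_map_id (M : discrModule S) :
  restrict_map (idfun : {linear M -> M}) =1 id.
Proof. by []. Qed.

Lemma restrict_map_comp (L M N : discrModule S)
    (h : {linear M -> N}) (g : {linear L -> M}) :
  restrict_map (h \o g : {linear L -> N}) =1 restrict_map h \o restrict_map g.
Proof. by []. Qed.

Definition restriction_fully_faithful : Prop :=
  forall M N : discrModule S, bijective (@restrict_map M N).

End RestrictionFunctor.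

(* Main.v *)
(* If the restriction functor is full and g, h : S/J -> T are ring maps that agree
   on R/I, then the identity of T is R-linear between the two discrete S-module
   structures on T defined by g and h; it is therefore S-linear, and evaluation
   at 1 gives g = h.

   Conversely, let h : M -> N be an R-linear map of discrete S-modules and x in M.
   By tautness, x is killed by f(I) for an open ideal I of R such that the closure
   J of f(I)S is an open two-sided ideal. An element of M or N is killed by f(I)
   if and only if it is killed by J, so h restricts to an R/I-linear map between
   the S/J-modules of elements killed by J. As R/I -> S/J is an epimorphism, this
   restriction is S-linear. *)
Require Import Defs.
From HB Require Import structures.
From mathcomp Require Import all_boot all_algebra.
From mathcomp Require Import all_classical.
From mathcomp Require Import topology tvs.

Set Implicit Arguments.
Unset Strict Implicit.
Unset Printing Implicit Defensive.

Import GRing.Theory.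

Local Open Scope classical_set_scope.
Local Open Scope ring_scope.

(** * Right modules as ring maps into endomorphism rings *)

Section EndomorphismRing.
Variable U : zmodType.

Definition zmod_endo_pred : {pred U -> U} := fun g => `[< zmod_morphism g >].

Fact zmod_endo_zmod_closed : zmod_closed zmod_endo_pred.
Proof.
split=> [|g h /asboolP gB /asboolP hB]; apply/asboolP => x y.
  by rewrite subr0.
by rewrite !fctE gB hB !opprD !opprK addrACA.
Qed.

HB.instance Definition _ :=
  GRing.isZmodClosed.Build (U -> U) zmod_endo_pred zmod_endo_zmod_closed.

Record zmod_endo := ZmodEndo {
  endo_fun :> U -> U;
  endo_funP : endo_fun \in zmod_endo_pred
}.

HB.instance Definition _ := [isSub for endo_fun].
HB.instance Definition _ := [Choice of zmod_endo by <:].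
HB.instance Definition _ := [SubChoice_isSubZmodule of zmod_endo by <:].

Lemma zmod_endoP (u v : zmod_endo) : u =1 v <-> u = v.
Proof. by split=> [/funext/val_inj|->]. Qed.

Lemma endoB (u : zmod_endo) : zmod_morphism u.
Proof. by have /asboolP := endo_funP u. Qed.

HB.instance Definition _ (u : zmod_endo) :=
  GRing.isZmodMorphism.Build U U u (endoB u).

Definition endo_of (g : {additive U -> U}) : zmod_endo :=
  ZmodEndo (introT (asboolP _) (raddfB g)).

Definition endo_one : zmod_endo := endo_of idfun.

(* Endomorphisms act on the right: u * v means u first, then v. *)
Definition endo_mul (u v : zmod_endo) : zmod_endo := endo_of (v \o u).

Fact endo_mulA : associative endo_mul.
Proof. by move=> u v w; apply/zmod_endoP. Qed.

Fact endo_mul1l : left_id endo_one endo_mul.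
Proof. by move=> u; apply/zmod_endoP. Qed.

Fact endo_mul1r : right_id endo_one endo_mul.
Proof. by move=> u; apply/zmod_endoP. Qed.

Fact endo_mulDl : left_distributive endo_mul +%R.
Proof. by move=> u v w; apply/zmod_endoP => x; exact: (raddfD w). Qed.

Fact endo_mulDr : right_distributive endo_mul +%R.
Proof. by move=> u v w; apply/zmod_endoP. Qed.

HB.instance Definition _ := GRing.Zmodule_isPzRing.Build zmod_endo
  endo_mulA endo_mul1l endo_mul1r endo_mulDl endo_mulDr.

End EndomorphismRing.

Section RightMultiplication.
Variables (B : pzRingType) (M : lmodType B^c).

(** This encodes the right action as a ring map out of [B]; it preserves the order of products
    because endomorphisms compose from left to right. *)
Definition rscale (b : B) : zmod_endo M :=
  endo_of ( *:%R (b : B^c) : {additive M -> M}).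

Fact rscale_zmod_morphism : zmod_morphism rscale.
Proof. by move=> b c; apply/zmod_endoP => x; exact: (scalerBl (b : B^c) c). Qed.

Fact rscale_monoid_morphism : monoid_morphism rscale.
Proof.
split; first by apply/zmod_endoP => x; exact: scale1r.
by move=> b c; apply/zmod_endoP => x; rewrite /= (scalerA (c : B^c) b x).
Qed.

HB.instance Definition _ :=
  GRing.isZmodMorphism.Build B (zmod_endo M) rscale rscale_zmod_morphism.
HB.instance Definition _ :=
  GRing.isMonoidMorphism.Build B (zmod_endo M) rscale rscale_monoid_morphism.

End RightMultiplication.

Section Conjugation.
Variables (A B : pzRingType) (p : {rmorphism A -> B}) (u v : B).
Hypotheses (uv1 : u * v = 1) (vu1 : v * u = 1).

Definition conj_rmorph (a : A) : B := u * p a * v.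

Fact conj_rmorph_zmod_morphism : zmod_morphism conj_rmorph.
Proof. by move=> a b; rewrite /conj_rmorph rmorphB mulrBr mulrBl. Qed.

Fact conj_rmorph_monoid_morphism : monoid_morphism conj_rmorph.
Proof.
split=> [|a b]; first by rewrite /conj_rmorph rmorph1 mulr1.
by rewrite /conj_rmorph rmorphM !mulrA -(mulrA _ v) vu1 mulr1.
Qed.

(** That [u] and [v] are mutually inverse is not visible in the formula [u * p a * v], so the
    bundled ring map is given by an existential. *)
Lemma conj_rmorph_exists : exists q : {rmorphism A -> B}, q =1 conj_rmorph.
Proof.
pose q : {rmorphism A -> B} := HB.pack conj_rmorph
  (GRing.isZmodMorphism.Build A B conj_rmorph conj_rmorph_zmod_morphism)
  (GRing.isMonoidMorphism.Build A B conj_rmorph conj_rmorph_monoid_morphism).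
by exists q.
Qed.

End Conjugation.

(** * Linearity along a ring epimorphism *)

Section EpimorphismLinear.
Variables (A B : pzRingType) (p : {rmorphism A -> B}) (M N : lmodType B^c).
Variable h : {additive M -> N}.

Definition shear_fun (x : M * N) : M * N := (x.1, x.2 + h x.1).
Definition unshear_fun (x : M * N) : M * N := (x.1, x.2 - h x.1).

Fact shear_zmod_morphism : zmod_morphism shear_fun.
Proof.
move=> x y; rewrite /shear_fun /= raddfB.
by congr pair; rewrite /= opprD addrACA.
Qed.

Fact unshear_zmod_morphism : zmod_morphism unshear_fun.
Proof.
move=> x y; rewrite /unshear_fun /= raddfB.
by congr pair; rewrite /= !opprD addrACA.
Qed.

HB.instance Definition _ :=
  GRing.isZmodMorphism.Build _ _ shear_fun shear_zmod_morphism.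
HB.instance Definition _ :=
  GRing.isZmodMorphism.Build _ _ unshear_fun unshear_zmod_morphism.

(* An A-linear h makes the shear automorphism (x, y) |-> (x, y + h x) of M * N
   commute with A, so the B-action on M * N and its conjugate by the shear are
   two ring maps out of B that agree on A. *)
Lemma ring_epimorphism_linear : ring_epimorphism p ->
  (forall (a : A) x, h ((p a : B^c) *: x) = (p a : B^c) *: h x) ->
  forall (b : B) x, h ((b : B^c) *: x) = (b : B^c) *: h x.
Proof.
move=> p_epi hA b x.
pose u : zmod_endo (M * N)%type := endo_of shear_fun.
pose v : zmod_endo (M * N)%type := endo_of unshear_fun.
have uv1 : u * v = 1.
  by apply/zmod_endoP => -[y z]; rewrite /= /unshear_fun /shear_fun /= addrK.
have vu1 : v * u = 1.
  by apply/zmod_endoP => -[y z]; rewrite /= /unshear_fun /shear_fun /= subrK.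
have [q qE] := conj_rmorph_exists (@rscale B (M * N)%type) uv1 vu1.
have : @rscale B (M * N)%type =1 q.
  apply: p_epi => a /=; rewrite qE; apply/zmod_endoP => -[y z].
  by rewrite /= /unshear_fun /shear_fun /= scalerDr hA addrK.
(* At [(x, 0)] the action of [b] has second component 0, and its conjugate has h x . b - h (x .
   b). *)
move=> /(_ b); rewrite qE => /zmod_endoP/(_ (x, 0))/(congr1 snd).
rewrite /= /shear_fun /= scaler0 add0r => /esym/eqP.
by rewrite subr_eq0 => /eqP/esym.
Qed.

End EpimorphismLinear.

(** * The elements killed by a two-sided ideal, as a module over the quotient ring *)

Section KilledSubmodule.
Variables (S : pzRingType) (J : twosidedIdeal S) (M : lmodType S^c).

Definition killed_pred : {pred M} :=
  fun x => `[< ideal_set J `<=` annihilator x >].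

Fact killed_zmod_closed : zmod_closed killed_pred.
Proof.
split=> [|x y /asboolP Jx /asboolP Jy]; apply/asboolP => s Js.
  exact: scaler0.
by rewrite /annihilator /= scalerBr (Jx _ Js) (Jy _ Js) subr0.
Qed.

HB.instance Definition _ :=
  GRing.isZmodClosed.Build M killed_pred killed_zmod_closed.

Record killed := Killed {
  killed_val :> M;
  killed_valP : killed_val \in killed_pred
}.

HB.instance Definition _ := [isSub for killed_val].
HB.instance Definition _ := [Choice of killed by <:].
HB.instance Definition _ := [SubChoice_isSubZmodule of killed by <:].

Lemma killed_val_inj : injective killed_val.
Proof. exact: val_inj. Qed.

Lemma killed_valD : {morph killed_val : x y / x + y}.
Proof. by []. Qed.

(** Here [J] is used as a left ideal: (x . s) . r = x . (s r), and s r lies in [J]. *)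
Lemma killed_scale_subproof (s : S) (x : killed) :
  (s : S^c) *: (x : M) \in killed_pred.
Proof.
have [[_ _ JL] _] := twosided_idealP J.
have /asboolP Jx := killed_valP x.
apply/asboolP => r Jr; rewrite /annihilator /= (scalerA (r : S^c) s).
exact: (Jx _ (JL s r Jr)).
Qed.

Definition killed_scale (b : (quotient_ring J)^c) (x : killed) : killed :=
  Killed (killed_scale_subproof (quotient_repr (b : quotient_ring J)) x).

(** Two representatives of a class differ by an element of [J], which kills [x], so any of them
    computes the action. The module axioms reduce to those of [M] this way. *)
Lemma killed_scale_proj (s : S) (x : killed) :
  killed_val (killed_scale (quotient_proj J s) x) = (s : S^c) *: (x : M).
Proof.
apply/eqP; rewrite -subr_eq0 /= -scalerBl; apply/eqP.
have /asboolP Jx := killed_valP x; apply: Jx.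
by apply/quotient_projP; rewrite quotient_reprK.
Qed.

Fact killed_scaleA a b x :
  killed_scale a (killed_scale b x) = killed_scale (a * b) x.
Proof.
apply: killed_val_inj; rewrite -(quotient_reprK a) -(quotient_reprK b).
move: (quotient_repr a) (quotient_repr b) => r s.
rewrite -[_ * _]/((quotient_proj J s : quotient_ring J) * quotient_proj J r).
by rewrite -rmorphM !killed_scale_proj (scalerA (r : S^c) s).
Qed.

Fact killed_scale1 : left_id 1 killed_scale.
Proof.
move=> x; apply: killed_val_inj.
rewrite -[1]/((1 : quotient_ring J) : (quotient_ring J)^c).
by rewrite -(rmorph1 (quotient_proj J)) killed_scale_proj (scale1r (x : M)).
Qed.

Fact killed_scaleDr : right_distributive killed_scale +%R.
Proof.
move=> b x y; apply: killed_val_inj.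
exact: scalerDr.
Qed.

Fact killed_scaleDl x : {morph killed_scale^~ x : a b / a + b}.
Proof.
move=> a b; apply: killed_val_inj; rewrite -(quotient_reprK a) -(quotient_reprK b).
move: (quotient_repr a) (quotient_repr b) => r s.
rewrite -[_ + _ in LHS]/((quotient_proj J r : quotient_ring J) +
  quotient_proj J s).
rewrite -rmorphD killed_valD !killed_scale_proj.
exact: (scalerDl (x : M) (r : S^c) (s : S^c)).
Qed.

HB.instance Definition _ :=
  GRing.Zmodule_isLmodule.Build (quotient_ring J)^c killed
    killed_scaleA killed_scale1 killed_scaleDr killed_scaleDl.

End KilledSubmodule.

(** * Open right ideals are closed *)

Section OpenRightIdeals.
Variables (R : topologicalPzRingType) (A : set R).
Hypothesis A_ideal : right_ideal A.

Lemma right_idealB x y : A x -> A y -> A (x - y).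
Proof.
case: A_ideal => _ AD AM Ax Ay.
by apply: AD => //; rewrite -mulrN1; exact: AM.
Qed.

Lemma nbhs_translate (U : set R) (x : R) :
  nbhs 0 U -> nbhs x [set y | U (y - x)].
Proof.
move=> U0; have : {for x, continuous (fun y : R => y - x)}.
  apply: (@continuous_comp _ _ _ (fun y : R => (y, x)) (fun z => z.1 - z.2)).
    by apply: cvg_pair => /=; [exact: cvg_id|exact: cvg_cst].
  exact: sub_continuous.
by move=> /(_ U); rewrite subrr => /(_ U0).
Qed.

(** With each point x the set contains the translate x + A, a neighbourhood of x. *)
Lemma right_ideal_open : nbhs 0 A -> open A.
Proof.
move=> A0; rewrite openE => x Ax.
apply: filterS (nbhs_translate x A0) => y /= Ayx.
by case: A_ideal => _ AD _; rewrite -(subrK x y); exact: AD.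
Qed.

(** If x is in the closure, the neighbourhood x + A meets [A] in some y, and x = y - (y - x). *)
Lemma open_right_ideal_closed : open A -> closed A.
Proof.
move=> Ao x Acl.
have A0 : nbhs 0 A by apply: open_nbhs_nbhs; split=> //; case: A_ideal.
have [y [Ay Ayx]] := Acl _ (nbhs_translate x A0).
by rewrite -(subKr y x); exact: right_idealB.
Qed.

End OpenRightIdeals.

(** * From full faithfulness to proepimorphisms *)

Lemma proepimorphism_of_fully_faithful (R S : topologicalPzRingType)
    (f : {rmorphism R -> S})
    (f_continuous : continuous f) :
  restriction_fully_faithful f_continuous -> topological_ring_proepimorphism f.
Proof.
move=> ff; split=> // I J fIJ Io Jo T g h gh b.
(* [(T^c)^o] is [T] as a right module over itself. The annihilators are open because they are right
   ideals containing the open ideal [J]. *)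
have discr (k : {rmorphism quotient_ring J -> T}) :
    discrete_module (Defs.restrict (k \o quotient_proj J : {rmorphism S -> T})
      (T^c)^o : lmodType S^c).
  move=> x; have Ax := annihilator_right_ideal x; split=> //.
  apply: right_ideal_open => //.
  have J0 : nbhs 0 (J : set S).
    by apply: open_nbhs_nbhs; split=> //; have [[]] := twosided_idealP J.
  apply: filterS J0 => s Js; rewrite /annihilator /=.
  have s0 : quotient_proj J s = 0.
    by rewrite -(raddf0 (quotient_proj J)); apply/quotient_projP; rewrite subr0.
  by rewrite -[LHS]/((x : T) * k (quotient_proj J s)) s0 rmorph0 mulr0.
pose M := DiscrModule (discr g); pose N := DiscrModule (discr h).
pose phi (x : restrict_obj f_continuous M) : restrict_obj f_continuous N := x.
have phi_lin : linear phi.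
  move=> r x y; rewrite /phi.
  have := gh (quotient_proj I r); rewrite /= !quotient_map_proj => ghr.
  congr (_ + _); rewrite -[LHS]/((x : T) * g (quotient_proj J (f r))).
  by rewrite ghr.
pose phiL : {linear restrict_obj f_continuous M -> restrict_obj f_continuous N} :=
  HB.pack phi (GRing.isLinear.Build R^c _ _ *:%R phi phi_lin).
have [inv _ invK] := ff M N.
(* Restriction of scalars keeps the underlying function, so the preimage of [phiL] is again the
   identity of [T], now as an S-linear map. *)
have psiE : forall x : T, (inv phiL : M -> N) x = x.
  by move=> x; have /(congr1 (fun k : {linear restrict_obj f_continuous M ->
    restrict_obj f_continuous N} => k x)) := invK phiL.
rewrite -(quotient_reprK b); move: (quotient_repr b) => s.
have := linearZZ (inv phiL) (s : S^c) ((1 : T) : M).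
rewrite !psiE -[X in X = _]/((1 : T) * g (quotient_proj J s)).
by rewrite -[X in _ = X]/((1 : T) * h (quotient_proj J s)) !mul1r.
Qed.

(** * From proepimorphisms to full faithfulness *)

Lemma proepimorphism_linear (R S : topologicalPzRingType)
    (f : {rmorphism R -> S})
    (f_taut : strongly_right_taut f) (M N : discrModule S)
    (h : {additive M -> N}) :
  topological_ring_proepimorphism f ->
  (forall (r : R) x, h ((f r : S^c) *: x) = (f r : S^c) *: h x) ->
  forall (s : S) x, h ((s : S^c) *: x) = (s : S^c) *: h x.
Proof.
(* By continuity the preimage of the open annihilator of [x] is a neighbourhood of 0; an ideal [I]
   inside it has f(I) killing [x]. *)
move=> [f_cont f_epi] hR s x; case: f_taut => _ /(_ (f @^-1` annihilator x)).
have [x_open x_ideal] := discr_lmodP x.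
case.
  apply: open_nbhs_nbhs; split; first by apply: open_comp => // ? _; exact: f_cont.
  by rewrite /= rmorph0; case: x_ideal.
move=> I [I_open I_ideal] [J_open J_ideal] Ix.
set J0 := closure _ in J_open J_ideal.
pose J := TwosidedIdeal J_ideal; pose I' := TwosidedIdeal I_ideal.
have fIJ : f @` I' `<=` J.
  by apply: subset_trans (@subset_closure _ _); exact: sub_gen_smallest.
(* An element of a discrete module killed by f(I) is killed by J, because its
   annihilator is a right ideal that is open, hence closed. *)
have killP (L : discrModule S) (y : L) :
    (forall r, I r -> (f r : S^c) *: y = 0) -> y \in @killed_pred S J L.
  move=> Iy; apply/asboolP; have [y_open y_ideal] := discr_lmodP y.
  have y_closed := open_right_ideal_closed y_ideal y_open.
  rewrite [annihilator y](closure_id _).1 //; apply: closureS.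
  by apply: smallest_sub => // _ [r Ir <-]; exact: Iy.
(* Since f(I) lies in [J], it kills [y] and, by [hR], also [h y]; [killP] passes from f(I) to
   [J]. *)
have hkill (y : killed J M) : h (killed_val y) \in @killed_pred S J N.
  apply: killP => r Ir; rewrite -hR.
  have /asboolP Jy := killed_valP y; rewrite (Jy (f r)) ?raddf0 //.
  by apply: fIJ; exists r.
pose k (y : killed J M) : killed J N := Killed (hkill y).
have kB : zmod_morphism k by move=> y z; apply: killed_val_inj; rewrite /= raddfB.
pose kA : {additive killed J M -> killed J N} :=
  HB.pack k (GRing.isZmodMorphism.Build _ _ k kB).
have x_killed : x \in @killed_pred S J M by apply: killP => r /Ix.
(* On killed elements the image of the class of r acts as [f r], so this is an instance of [hR]. *)
have kZ (a : quotient_ring I') y :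
    kA ((quotient_map fIJ a : (quotient_ring J)^c) *: y) =
      (quotient_map fIJ a : (quotient_ring J)^c) *: kA y.
  rewrite -(quotient_reprK a) quotient_map_proj; apply: killed_val_inj.
  apply: etrans (esym (killed_scale_proj (f (quotient_repr a)) (kA y))).
  by rewrite -[RHS]hR; congr (h _); exact: killed_scale_proj.
have := ring_epimorphism_linear (f_epi I' J fIJ I_open J_open) kZ
  (quotient_proj J s) (Killed x_killed).
move/(congr1 (@killed_val _ _ _)) => hs.
apply: etrans (etrans hs (killed_scale_proj s (kA (Killed x_killed)))).
by congr (h _); rewrite -[LHS](killed_scale_proj s (Killed x_killed)).
Qed.

(** Bijectivity on morphisms concerns equality of bundled maps; proof irrelevance identifies the
    bundled proofs once the functions agree. *)
Lemma linear_ext (A : pzRingType) (M N : lmodType A) (g h : {linear M -> N}) :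
  g =1 h -> g = h.
Proof.
case: g h => g [[g1] [g2]] [h [[h1] [h2]]] /= /funext gh.
rewrite -gh in h1 h2 *.
by rewrite (Prop_irrelevance h1 g1) (Prop_irrelevance h2 g2).
Qed.

Theorem proposition7p6 (R S : topologicalPzRingType) (f : {rmorphism R -> S})
    (f_continuous : continuous f)
    (R_linear : two_sided_linear R) (S_linear : two_sided_linear S)
    (f_taut : strongly_right_taut f) :
  restriction_fully_faithful f_continuous <-> topological_ring_proepimorphism f.
Proof.
split=> [|f_epi M N]; first exact: proepimorphism_of_fully_faithful.
have hlin (h : {linear restrict_obj f_continuous M ->
    restrict_obj f_continuous N}) : linear (h : M -> N).
  have hZ := proepimorphism_linear f_taut (h := h : {additive M -> N}) f_epi.
  move=> s x y; rewrite -hZ; last by move=> r z; exact: (linearZZ h r z).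
  exact: (raddfD h).
pose inv (h : {linear restrict_obj f_continuous M ->
    restrict_obj f_continuous N}) : {linear M -> N} :=
  HB.pack (h : M -> N) (GRing.isLinear.Build S^c M N *:%R (h : M -> N) (hlin h)).
(* Both [inv] and [restrict_map] keep the underlying function, so each composite is pointwise the
   identity. *)
exists inv => h; exact: linear_ext.
Qed.
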